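(* Write $\phi=\phi(q^{16})$, $\psi=\psi(q^{32})$, $\psi_1=\psi_1(q^{16})$ and $\psi_2=\psi_2(q^{16})$. Then, as formal power series in $q$ with integer coefficients, \begin{align*} \sum_{n\geq0}\overline{p}(n)q^n \equiv \frac{\phi^{12}}{\phi(-q^{16})^{16}}\Big(&\phi^{3} - 2\left(4q^{16}\psi^2\psi_2+7\phi^{2}\psi_1\right)q + 4\phi\left(q^{16}\psi_2^2+\psi_1^2\right)q^2 + 8\psi_1\left(q^{16}\psi_2^2+\psi_1^2\right)q^3\\ & + 2\phi\left(4\psi(q^{16})^2+3\phi\psi\right)q^4 + 8\phi\psi\psi_1q^5 + 8\psi\left(q^{16}\psi_2^2+\psi_1^2\right)q^6 + 4\phi\psi^2q^8\\ & - 2\left(7\phi^{2}\psi_2+4\psi^2\psi_1\right)q^9 + 8\phi\psi_1\psi_2q^{10} + 8\psi_2\left(q^{16}\psi_2^2+\psi_1^2\right)q^{11}\\ & + 8\psi^3q^{12} + 8\phi\psi\psi_2q^{13}\Big) \pmod{16}, \end{align*} where the congruence means that corresponding coefficients of the two power series are congruent modulo $16$.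
   Context: An overpartition of a nonnegative integer $n$ is a partition of $n$ in which the first occurrence of each distinct part may be overlined. $\overline{p}(n)$ denotes the number of overpartitions of $n$ (with $\overline{p}(0)=1$). Its generating function is $\sum_{n\ge 0}\overline{p}(n)q^n=\prod_{m\ge 1}\frac{1+q^m}{1-q^m}$. The following power series in $q$ are used: $$\phi(q)=\sum_{n=-\infty}^{\infty}q^{n^2},\qquad \psi(q)=\sum_{n=0}^{\infty}q^{(n^2+n)/2},$$ $$\psi_1(q)=\sum_{n=-\infty}^{\infty}q^{4n^2+n},\qquad \psi_2(q)=\sum_{n=-\infty}^{\infty}q^{4n^2-3n},$$ so that $\psi(q)=\psi_1(q^2)+q\,\psi_2(q^2)$. A symbol such as $\phi(-q^{16})$ means the series $\phi$ evaluated at $-q^{16}$. *)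

(* Defs.v *)
From HB Require Import structures.
From mathcomp Require Import all_boot all_order all_algebra.
From mathcomp Require Import boolp classical_sets functions cardinality fsbigop.

Set Implicit Arguments.
Unset Strict Implicit.
Unset Printing Implicit Defensive.

Import GRing.Theory.
Local Open Scope ring_scope.

(* Formal power series as coefficient sequences: [f n] is the coefficient of
   q ^ n in f. *)
Record fps (R : Type) : Type := Fps { fps_coef :> nat -> R }.

Lemma fpsP (R : Type) (f g : fps R) : (forall n, f n = g n) <-> f = g.
Proof.
split=> [|-> //]; case: f g => f [g] /= fg.
by congr Fps; apply/funext.
Qed.

HB.instance Definition _ (R : Type) := gen_eqMixin (fps R).
HB.instance Definition _ (R : Type) := gen_choiceMixin (fps R).

Section FpsRing.
Variable R : comUnitRingType.
Implicit Types f g h : fps R.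

Definition fps_zero : fps R := Fps (fun=> 0).
Definition fps_add f g : fps R := Fps (fun n => f n + g n).
Definition fps_opp f : fps R := Fps (fun n => - f n).

Lemma fps_addA : associative fps_add.
Proof. by move=> f g h; apply/fpsP => n; apply: addrA. Qed.
Lemma fps_addC : commutative fps_add.
Proof. by move=> f g; apply/fpsP => n; apply: addrC. Qed.
Lemma fps_add0 : left_id fps_zero fps_add.
Proof. by move=> f; apply/fpsP => n; apply: add0r. Qed.
Lemma fps_addN : left_inverse fps_zero fps_opp fps_add.
Proof. by move=> f; apply/fpsP => n; apply: addNr. Qed.

HB.instance Definition _ :=
  GRing.isZmodule.Build (fps R) fps_addA fps_addC fps_add0 fps_addN.

Definition fps_one : fps R := Fps (fun n => (n == 0%N)%:R).
Definition fps_mul f g : fps R :=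
  Fps (fun n => \sum_(i < n.+1) f i * g (n - i)%N).

Lemma fps_mul_poly (p q : {poly R}) f g n :
  (forall i, (i <= n)%N -> p`_i = f i) ->
  (forall i, (i <= n)%N -> q`_i = g i) ->
  (p * q)`_n = fps_mul f g n.
Proof.
move=> pf qg; rewrite coefM; apply: eq_bigr => i _.
by rewrite pf ?qg ?leq_subr // -ltnS.
Qed.

Let trunc n f : {poly R} := \poly_(i < n.+1) f i.

Let truncE n f i : (i <= n)%N -> (trunc n f)`_i = f i.
Proof. by move=> le_in; rewrite coef_poly ltnS le_in. Qed.

Let trunc_mul n f g i :
  (i <= n)%N -> (trunc n f * trunc n g)`_i = fps_mul f g i.
Proof.
by move=> le_in; apply: fps_mul_poly => j le_ji;
  apply: truncE; apply: leq_trans le_in.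
Qed.

Lemma fps_mulA : associative fps_mul.
Proof.
move=> f g h; apply/fpsP => n.
rewrite -(@fps_mul_poly (trunc n f) (trunc n g * trunc n h)).
- rewrite mulrA; apply: fps_mul_poly => i; [exact: trunc_mul | exact: truncE].
- exact: truncE.
- exact: trunc_mul.
Qed.

Lemma fps_mulC : commutative fps_mul.
Proof.
by move=> f g; apply/fpsP => n; rewrite -!(@trunc_mul n) // mulrC.
Qed.

Lemma fps_mul1 : left_id fps_one fps_mul.
Proof.
move=> f; apply/fpsP => n; rewrite -(@fps_mul_poly 1 (trunc n f)).
- by rewrite mul1r truncE.
- by move=> i _; rewrite coef1.
- exact: truncE.
Qed.

Lemma fps_mulDl : left_distributive fps_mul fps_add.
Proof.
move=> f g h; apply/fpsP => n /=; rewrite -big_split /=.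
by apply: eq_bigr => i _; rewrite mulrDl.
Qed.

Lemma fps_one_neq0 : fps_one != 0.
Proof.
by apply/eqP => /fpsP/(_ 0%N) /eqP /=; rewrite (negPf (oner_neq0 R)).
Qed.

HB.instance Definition _ :=
  GRing.Zmodule_isComNzRing.Build (fps R)
    fps_mulA fps_mulC fps_mul1 fps_mulDl fps_one_neq0.

(* [fps_inv_prefix f n] lists the first n coefficients of the inverse of f,
   each obtained by solving (f^-1 * f) n = (n == 0)%:R for f^-1 n. *)
Definition fps_inv_next f (s : seq R) : R :=
  (f 0%N)^-1 *
    ((size s == 0%N)%:R - \sum_(i < size s) s`_i * f (size s - i)%N).
Definition fps_inv_prefix f n : seq R :=
  iter n (fun s => rcons s (fps_inv_next f s)) [::].

Definition fps_unit : pred (fps R) := fun f => f 0%N \is a GRing.unit.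
Definition fps_inv f : fps R :=
  if fps_unit f then Fps (fun n => (fps_inv_prefix f n.+1)`_n) else f.

Lemma size_fps_inv_prefix f n : size (fps_inv_prefix f n) = n.
Proof. by elim: n => //= n IHn; rewrite size_rcons IHn. Qed.

Lemma nth_fps_inv_prefix f n i : (i < n)%N ->
  (fps_inv_prefix f n)`_i = (fps_inv_prefix f i.+1)`_i.
Proof.
elim: n => // n IHn; rewrite ltnS leq_eqVlt => /predU1P[-> //|lt_in].
by rewrite {1}/fps_inv_prefix iterS nth_rcons size_fps_inv_prefix lt_in IHn.
Qed.

Lemma fps_mulV : {in fps_unit, left_inverse 1 fps_inv *%R}.
Proof.
move=> f Uf; have Uf0 : f 0%N \is a GRing.unit by [].
apply/fpsP => n; rewrite /fps_inv [fps_unit f]Uf0 /= big_ord_recr /= subnn.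
rewrite nth_rcons size_fps_inv_prefix ltnn eqxx /fps_inv_next.
rewrite size_fps_inv_prefix mulrAC mulVr // mul1r addrC -[RHS]addr0 -addrA.
congr (_ + _); rewrite addrC; apply/eqP; rewrite subr_eq0; apply/eqP.
apply: eq_bigr => i _; congr (_ * _).
exact/esym/nth_fps_inv_prefix/ltn_ord.
Qed.

Lemma fps_unitPl f g : g * f = 1 -> fps_unit f.
Proof.
move/fpsP/(_ 0%N); rewrite /= big_ord_recl big_ord0 addr0 subnn => gf1.
by apply/unitrPr; exists (g 0%N); rewrite mulrC.
Qed.

Lemma fps_inv_out : {in [predC fps_unit], fps_inv =1 id}.
Proof. by move=> f; rewrite inE /fps_inv /in_mem /= => /negPf->. Qed.

HB.instance Definition _ :=
  GRing.ComNzRing_hasMulInverse.Build (fps R)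
    fps_mulV fps_unitPl fps_inv_out.

Definition fpsX : fps R := Fps (fun n => (n == 1%N)%:R).

(* Sum of a locally finite family: for each n, only finitely many members F k
   may have a nonzero coefficient of q ^ n (otherwise the finitely supported
   sum below is 0 by convention). *)
Definition fps_sum (I : choiceType) (F : I -> fps R) : fps R :=
  Fps (fun n => \sum_(k \in [set: I]) F k n).

(* Substitution f(g), meaningful when g 0 = 0: then g ^+ i has no terms of
   degree below i, so the terms of f(g) = \sum_i f_i g^i with i > n do not
   contribute to the coefficient of q ^ n. *)
Definition fps_subst f g : fps R :=
  Fps (fun n => \sum_(i < n.+1) f i * (g ^+ i) n).

End FpsRing.

Notation "''q'" := (fpsX int) (at level 0) : ring_scope.

(* The exponents are nonnegative for every integer k, so ^ is here a power with
   a natural exponent; no inverse of 'q is involved. *)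
Definition phi_series : fps int := fps_sum (fun k : int => 'q ^ (k ^+ 2)).
Definition psi_series : fps int :=
  fps_sum (fun k : nat => 'q ^+ ((k ^ 2 + k) %/ 2)%N).
Definition psi1_series : fps int :=
  fps_sum (fun k : int => 'q ^ (4 * k ^+ 2 + k)).
Definition psi2_series : fps int :=
  fps_sum (fun k : int => 'q ^ (4 * k ^+ 2 - 3 * k)).

(* An overpartition of n is a weakly decreasing sequence of positive parts with
   sum n; each part carries a boolean telling whether it is overlined, which is
   only allowed at the first occurrence of a part. *)
Definition is_overpartition (n : nat) (s : seq (nat * bool)) : bool :=
  let parts := [seq x.1 | x <- s] in
  [&& sorted geq parts, all (leq 1%N) parts, sumn parts == n
    & [forall i : 'I_(size s),
         (nth (0%N, false) s i).2 ==> ((nth (0%N, false) s i).1 \notin take i parts)]].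

(* An overpartition of n has at most n parts, each at most n, hence all of them
   are found in the finite type n.-bseq ('I_n.+1 * bool). *)
Definition overp (n : nat) : nat :=
  #|[set s : n.-bseq ('I_n.+1 * bool)
      | is_overpartition n [seq (val x.1, x.2) | x <- s]]|.

Definition overp_series : fps int := Fps (fun n => (overp n)%:Z).

(* Main.v *)
Require Import Defs.
From HB Require Import structures.
From mathcomp Require Import all_boot all_order all_algebra.
From mathcomp Require Import boolp classical_sets fsbigop.
From mathcomp Require Import zify ring.

(** Write a(q) = phi(-q).  The overpartition series is 1 / a(q), which is the
    product formula for overpartitions combined with the theorem of Gauss that
    phi(-q) is the product of the (1 - q^m) / (1 + q^m) over m >= 1
    ([overp_alternate_phi]).

    From phi(q) = phi(q^4) + 2 q psi(q^8) and
    phi(q)^2 = phi(q^2)^2 + 4 q psi(q^4)^2 one gets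
    phi(q) phi(-q) = phi(-q^2)^2.  Multiplying numerator and denominator of
    1 / phi(-q) by phi(q), then by phi(q^2)^2, phi(q^4)^4 and phi(q^8)^8, turns
    the denominator into phi(-q^16)^16 ([overp_series_phi16]):

      sum overp(n) q^n
        = phi(q) phi(q^2)^2 phi(q^4)^4 phi(q^8)^8 / phi(-q^16)^16.

    With the same two relations and psi(q) = psi_1(q^2) + q psi_2(q^2), the
    numerator becomes a polynomial in q, phi(q^16), psi(q^32), psi_1(q^16) and
    psi_2(q^16).  Modulo 16 it equals phi(q^16)^12 times the thirteen-term
    expression of the theorem ([product_mod16]); beyond expanding, this takes
    phi = 1 and psi(q)^2 = psi(q^2) modulo 2.

    All relations between theta series are proved by counting: a theta series
    is the generating function of a weight k |-> w(k) on some index type, and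
    an identity amounts to cutting the index type into pieces
    ([gf_split], [gfM]).

    For Gauss's theorem, no infinite product is needed.  Let Q_n be the series
    of overpartitions into parts at most n.  The n-th partial sum
    S_n = sum_(|k| <= n) (-1)^k q^(k^2) satisfies an exact identity
    Q_n S_n = 1 + q^(n+1) (...), proved by induction on n with a telescoping sum
    ([partial_theta_tail]).  As Q_n and S_n agree with the full series up to
    degree n, comparing coefficients of q^n is enough. *)

Set Implicit Arguments.
Unset Strict Implicit.
Unset Printing Implicit Defensive.

Import Order.TTheory GRing.Theory Num.Theory.
Local Open Scope ring_scope.

(** * Coefficients and substitutions of formal power series *)

Section FpsOperations.
Variable R : comUnitRingType.
Implicit Types f g : fps R.

Lemma fps_coefD f g n : (f + g) n = f n + g n. Proof. by []. Qed.

Lemma sum_ord_single (F : nat -> R) k n : (k < n)%N ->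
  (forall i, i != k -> F i = 0) -> \sum_(i < n) F i = F k.
Proof.
move=> lt_kn F0; rewrite (bigD1 (Ordinal lt_kn)) //= big1 ?addr0 // => i.
by rewrite -val_eqE => /F0.
Qed.

Lemma fps_coefN f n : (- f) n = - f n. Proof. by []. Qed.

Lemma fps_coefX n : fpsX R n = (n == 1%N)%:R. Proof. by []. Qed.

Lemma fps_coef1 n : (1 : fps R) n = (n == 0%N)%:R. Proof. by []. Qed.

Lemma fps_coefM f g n : (f * g) n = \sum_(i < n.+1) f i * g (n - i)%N.
Proof. by []. Qed.

Lemma fps_coefMn f k n : (f *+ k) n = f n *+ k.
Proof. by elim: k => // k IHk; rewrite !mulrS fps_coefD IHk. Qed.

Lemma fps_coef_sum (I : Type) (r : seq I) (F : I -> fps R) n :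
  (\sum_(i <- r) F i) n = \sum_(i <- r) F i n.
Proof.
exact: (big_morph (fun f : fps R => f n) (fun f g => fps_coefD f g n) (erefl
  _)).
Qed.

Lemma fps_coefXnM f k n :
  (fpsX R ^+ k * f) n = if (k <= n)%N then f (n - k)%N else 0.
Proof.
elim: k n => [|k IHk] n; first by rewrite mul1r subn0.
rewrite exprS -mulrA fps_coefM; case: n => [|n].
  by rewrite big_ord_recl big_ord0 mul0r addr0.
rewrite (@sum_ord_single (fun i => fpsX R i * (fpsX R ^+ k * f) (n.+1 - i)%N)
  1).
- by rewrite mul1r subn1 IHk.
- by [].
by move=> i /negPf i1; rewrite fps_coefX i1 mul0r.
Qed.

Lemma fps_coefXn k n : (fpsX R ^+ k) n = (n == k)%:R.
Proof.
rewrite -[_ ^+ k]mulr1 fps_coefXnM fps_coef1 subn_eq0 eqn_leq andbC.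
by case: leqP.
Qed.

Lemma fps_unit1 f : f 0%N = 1 -> f \is a GRing.unit.
Proof.
by move=> f0; have: f 0%N \is a GRing.unit by rewrite f0 unitr1.
Qed.

Definition dilate (m : nat) f : fps R :=
  Fps (fun n => if (m %| n)%N then f (n %/ m)%N else 0).

Definition alternate f : fps R := Fps (fun n => (-1) ^+ n * f n).

(** Truncating at degree n turns q -> q^m into the polynomial composition with
    'X^m, which is known to be multiplicative. *)
Lemma dilateM m f g : (0 < m)%N -> dilate m (f * g) = dilate m f * dilate m g.
Proof.
move=> m_gt0; apply/fpsP => n.
pose trunc (h : fps R) : {poly R} := \poly_(i < n.+1) h i.
have dilateE (h : fps R) i : (i <= n)%N -> (trunc h \Po 'X^m)`_i = dilate m h i.
  move=> le_in; rewrite coef_comp_poly_Xn //=; case: ifP => // _.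
  by rewrite coef_poly ltnS (leq_trans (leq_div i m)).
rewrite [RHS]fps_coefM -[RHS](fps_mul_poly (dilateE f) (dilateE g)).
rewrite -comp_polyM coef_comp_poly_Xn //=; case: ifP => // _.
have truncE (h : fps R) i : (i <= n %/ m)%N -> (trunc h)`_i = h i.
  by move=> le_i; rewrite coef_poly ltnS (leq_trans le_i (leq_div n m)).
by rewrite (fps_mul_poly (truncE f) (truncE g)).
Qed.

Lemma dilate_zmod_morphism m : zmod_morphism (dilate m).
Proof. by move=> f g; apply/fpsP => n /=; case: ifP => //; rewrite subr0. Qed.

Lemma dilate_monoid_morphism m : monoid_morphism (dilate m.+1).
Proof.
split=> [|f g]; last exact: dilateM.
apply/fpsP => n /=; case: ifP => [/dvdnP[k ->]|]; last by case: n.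
by rewrite mulnK // muln_eq0 orbF.
Qed.

HB.instance Definition _ m :=
  GRing.isZmodMorphism.Build (fps R) (fps R) (dilate m)
    (dilate_zmod_morphism m).
HB.instance Definition _ m :=
  GRing.isMonoidMorphism.Build (fps R) (fps R) (dilate m.+1)
    (dilate_monoid_morphism m).

Lemma alternate_zmod_morphism : zmod_morphism alternate.
Proof. by move=> f g; apply/fpsP => n; apply: mulrBr. Qed.

Lemma alternate_monoid_morphism : monoid_morphism alternate.
Proof.
split=> [|f g]; apply/fpsP => n /=; first by case: n => [|n];
  rewrite ?mulr1 ?mulr0.
rewrite mulr_sumr; apply: eq_bigr => i _.
by rewrite mulrACA -exprD subnKC // -ltnS.
Qed.

HB.instance Definition _ :=
  GRing.isZmodMorphism.Build (fps R) (fps R) alternate alternate_zmod_morphism.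
HB.instance Definition _ :=
  GRing.isMonoidMorphism.Build (fps R) (fps R) alternate
    alternate_monoid_morphism.

Lemma dilateX m : dilate m.+1 (fpsX R) = fpsX R ^+ m.+1.
Proof.
apply/fpsP => n; rewrite fps_coefXn /=.
case: ifP => [/dvdnP[k ->]|];
  first by rewrite mulnK // -{2}[m.+1]mul1n eqn_pmul2r.
by case: eqP => // ->; rewrite dvdnn.
Qed.

Lemma alternateX : alternate (fpsX R) = - fpsX R.
Proof.
by apply/fpsP => -[|[|n]] /=; rewrite ?mulr0 ?oppr0 // expr1 mulN1r.
Qed.

Lemma dilate_dilate m k f : dilate m.+1 (dilate k.+1 f) = dilate (k.+1 * m.+1)
  f.
Proof.
apply/fpsP => n /=; case: ifP => [/dvdnP[j ->]|m'n].
  by rewrite mulnK // dvdn_pmul2r // divnMr.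
by case: ifP => // kmn; rewrite (dvdn_trans _ kmn) ?dvdn_mull in m'n.
Qed.

(** A series in q^2 does not see the sign of q. *)
Lemma alternate_dilate m f : ~~ odd m -> alternate (dilate m f) = dilate m f.
Proof.
move=> m_even; apply/fpsP => n /=; case: ifP => [/dvdnP[k ->]|];
  last by rewrite mulr0.
by rewrite -signr_odd oddM (negPf m_even) andbF mul1r.
Qed.

(** The powers of c q^m are the monomials c^i q^(m i), so each coefficient of
    the substitution receives at most one term. *)
Lemma fps_subst_monomial f (c : R) m n : (0 < m)%N ->
  fps_subst f (Fps (fun k => c *+ (k == m))) n =
    if (m %| n)%N then c ^+ (n %/ m) * f (n %/ m)%N else 0.
Proof.
move=> m_gt0 /=; set g := Fps _.
have gE i : (g ^+ i) = Fps (fun k => c ^+ i *+ (k == i * m)%N).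
  elim: i => [|i IHi]; apply/fpsP => k /=.
    by rewrite mul0n.
  rewrite exprS IHi fps_coefM /=.
  case: (leqP m k) => [le_mk|lt_km].
    rewrite (@sum_ord_single (fun j => c *+ (j == m) *
                                (c ^+ i *+ (k - j == i * m)%N)) m) //.
      by rewrite eqxx mulrnAr exprS mulSn -(eqn_add2l m) subnKC.
    by move=> j /negPf->; rewrite mul0r.
  rewrite big1 => [|j _]; last by rewrite ltn_eqF ?mul0r // (leq_trans _ lt_km).
  by rewrite mulSn ltn_eqF // ltn_addr.
under eq_bigr do rewrite gE /=.
case: ifP => [/dvdnP[j ->]|m'n].
  rewrite mulnK // (@sum_ord_single (fun i => f i *
                      (c ^+ i *+ (j * m == i * m)%N)) j) ?ltnS ?leq_pmulr //.
    by rewrite eqxx mulrC.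
  by move=> i; rewrite eqn_pmul2r // eq_sym => /negPf->; rewrite mulr0.
apply: big1 => i _; case: eqP => [nE|]; last by rewrite mulr0.
by rewrite nE dvdn_mull in m'n.
Qed.

Lemma fps_subst_Xn f m : fps_subst f (fpsX R ^+ m.+1) = dilate m.+1 f.
Proof.
have -> : fpsX R ^+ m.+1 = Fps (fun k => 1 *+ (k == m.+1)).
  by apply/fpsP => k; rewrite fps_coefXn.
by apply/fpsP => n; rewrite fps_subst_monomial //= expr1n mul1r.
Qed.

Lemma fps_subst_oppXn f m :
  fps_subst f (- fpsX R ^+ m.+1) = dilate m.+1 (alternate f).
Proof.
have -> : - fpsX R ^+ m.+1 = Fps (fun k => (-1) *+ (k == m.+1)).
  by apply/fpsP => k; rewrite fps_coefN fps_coefXn -mulNrn.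
by apply/fpsP => n; rewrite fps_subst_monomial.
Qed.

End FpsOperations.

(** * Generating functions of weights *)

(** Weights are integers rather than natural numbers so that the quadratic
    forms involved can be compared by ring identities. *)
Definition gf (I : choiceType) (w : I -> int) : fps int :=
  Fps (fun n => \sum_(k \in [set: I]%classic) ((w k == n%:Z)%:R : int)).

(** Finiteness is stated through lists covering the bounded weights because
    such lists transport along sums and products of index types. *)
Definition proper_weight (I : choiceType) (w : I -> int) : Prop :=
  (forall k, 0 <= w k) /\
  forall n : nat, exists s : seq I, forall k, w k <= n%:Z -> k \in s.

Section GeneratingFunctions.
Implicit Types I J K : choiceType.

Lemma gf_seq I (w : I -> int) n (s : seq I) : uniq s ->
  (forall k, w k = n%:Z -> k \in s) ->
  gf w n = \sum_(k <- s) ((w k == n%:Z)%:R : int).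
Proof.
move=> Us sP; rewrite /gf /= (fsbigE s) //.
  by apply: eq_bigl => k; rewrite in_setT.
by move=> k _ /negP ks; case: eqP => // /sP.
Qed.

Lemma eq_gf I (w w' : I -> int) : w =1 w' -> gf w = gf w'.
Proof. by move=> ww'; congr gf; apply/funext. Qed.

Lemma proper_seq I (w : I -> int) n : proper_weight w ->
  exists2 s : seq I, uniq s & forall k, w k <= n%:Z -> k \in s.
Proof.
move=> [_ /(_ n)[s sP]]; exists (undup s); first exact: undup_uniq.
by move=> k /sP; rewrite mem_undup.
Qed.

Lemma proper_comp I J (w : I -> int) (f : J -> I) :
  injective f -> proper_weight w -> proper_weight (w \o f).
Proof.
move=> f_inj [w0 wfin]; split=> [k|n]; first exact: w0.
have [s sP] := wfin n; exists (pmap (fun i => if pselect (exists j, f j = i)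
   is left ex then Some (projT1 (cid ex)) else None) s) => k /sP ks.
rewrite mem_pmap; apply/mapP; exists (f k) => //.
case: pselect => [ex|[]]; last by exists k.
by congr Some; apply: f_inj; rewrite (projT2 (cid ex)).
Qed.

Lemma gf_bij I J (w : I -> int) (h : J -> I) :
  bijective h -> gf w = gf (w \o h).
Proof. by move=> hB; apply/fpsP => n; apply: reindex_fsbigT. Qed.

(** The index type I is the disjoint union of the images of f and g, so
    counting on I is counting on J and on K. *)
Lemma gf_split I J K (w : I -> int) (f : J -> I) (g : K -> I) :
  proper_weight w -> injective f -> injective g -> (forall j k, f j <> g k) ->
  (forall i, (exists j, i = f j) \/ (exists k, i = g k)) ->
  gf w = gf (w \o f) + gf (w \o g).
Proof.
move=> wP f_inj g_inj fg cover; apply/fpsP => n.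
have [s Us sP] := proper_seq n (proper_comp f_inj wP).
have [t Ut tP] := proper_seq n (proper_comp g_inj wP).
rewrite fps_coefD (@gf_seq _ (w \o f) _ s) // => [|k wk]; last first.
  by apply: sP; rewrite wk.
rewrite (@gf_seq _ (w \o g) _ t) // => [|k wk]; last first.
  by apply: tP; rewrite wk.
rewrite (@gf_seq _ w _ (map f s ++ map g t)).
- by rewrite big_cat !big_map.
- rewrite cat_uniq !map_inj_uniq // Us Ut andbT /=.
  apply/hasPn => _ /mapP[k _ ->]; apply/mapP => -[j _] /esym; exact: fg.
move=> i wi; rewrite mem_cat; have [[j iE]|[k iE]] := cover i;
  rewrite iE in wi *.
  by rewrite map_f // sP //= wi.
by rewrite (map_f g) ?orbT // tP //= wi.
Qed.

Lemma proper_pair I J (w : I -> int) (v : J -> int) :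
  proper_weight w -> proper_weight v ->
    proper_weight (fun p : I * J => w p.1 + v p.2).
Proof.
move=> [w0 wfin] [v0 vfin]; split=> [p|n]; first by rewrite addr_ge0.
have [s sP] := wfin n; have [t tP] := vfin n.
exists (allpairs pair s t) => -[i j] /= ij_le; apply/allpairs_f.
  by apply: sP; apply: le_trans ij_le; rewrite lerDl.
by apply: tP; apply: le_trans ij_le; rewrite lerDr.
Qed.

(** The coefficient of q^n in the product counts pairs (k, l) according to the
    value i of w k, and for a given pair only one i contributes. *)
Lemma gfM I J (w : I -> int) (v : J -> int) : proper_weight w ->
  proper_weight v ->
  gf w * gf v = gf (fun p : I * J => w p.1 + v p.2).
Proof.
move=> wP vP; have [w0 _] := wP; have [v0 _] := vP; apply/fpsP => n.
have [s Us sP] := proper_seq n wP; have [t Ut tP] := proper_seq n vP.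
rewrite (@gf_seq _ _ _ (allpairs pair s t)); last 2 first.
- by apply: allpairs_uniq => // -[i j] [i' j'] _ _ [-> ->].
- move=> [i j] /= ij; apply/allpairs_f; [apply: sP|apply: tP];
  by rewrite -ij (lerDl, lerDr).
rewrite fps_coefM.
under eq_bigr => i _.
  rewrite (@gf_seq _ w i s) // => [|k wk]; last by apply: sP;
    rewrite wk lez_nat -ltnS.
  rewrite (@gf_seq _ v (n - i) t) // => [|k wk]; last by apply: tP;
    rewrite wk lez_nat leq_subr.
  rewrite big_distrl /=; under eq_bigr do rewrite big_distrr /=.
  over.
rewrite exchange_big big_allpairs /=; apply: eq_bigr => k _.
rewrite exchange_big; apply: eq_bigr => l _ /=.
case: (boolP (w k + v l == n%:Z)) => [/eqP kl|kl].
  have [a wk] : exists a : nat, w k = a by exists `|w k|%N; rewrite gez0_abs.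
  have vl : v l = (n - a)%N by have := v0 l; lia.
  have a_n : (a < n.+1)%N by have := v0 l; lia.
  rewrite (@sum_ord_single _ (fun i => (w k == i%:Z)%:R * (v l == (n -
    i)%N%:Z)%:R) a) //.
    by rewrite wk vl !eqxx.
  by move=> i; rewrite wk eqz_nat eq_sym => /negPf->; rewrite mul0r.
apply: big1 => i _; case: eqP => [wk|]; last by rewrite mul0r.
case: eqP => [vl|]; last by rewrite mulr0.
by case/eqP: kl; have := ltn_ord i; lia.
Qed.

Lemma dilate_gf I (w : I -> int) m :
  dilate m.+1 (gf w) = gf (fun k => m.+1%:Z * w k).
Proof.
apply/fpsP => n /=; case: ifP => [/dvdnP[k ->]|m'n].
  rewrite mulnK //; apply: eq_fsbigr => i _; congr (_ %:R).
  by rewrite mulnC PoszM (inj_eq (mulfI _)).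
rewrite fsbig1 // => i _; case: eqP => // wi.
have: (m.+1%:Z %| n%:Z)%Z by apply/dvdzP; exists (w i); rewrite -wi mulrC.
by rewrite dvdzE /= m'n.
Qed.

Lemma mulXn_gf I (w : I -> int) m : (forall k, 0 <= w k) ->
  'q ^+ m * gf w = gf (fun k => m%:Z + w k).
Proof.
move=> w0; apply/fpsP => n; rewrite fps_coefXnM; case: leqP => [le_mn|lt_nm] /=.
  apply: eq_fsbigr => i _; congr (_ %:R); apply/eqP/eqP; lia.
rewrite fsbig1 // => i _; case: eqP => // wi; have := w0 i; lia.
Qed.

Lemma gf_unit : gf (fun _ : unit => 0) = 1.
Proof.
apply/fpsP => n; rewrite (@gf_seq _ _ _ [:: tt]) ?big_seq1 //.
by rewrite fps_coef1 -[0]/(Posz 0) eqz_nat eq_sym.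
Qed.

(** The bound is off by one so that it also covers k (k + 1), which vanishes
    at k = -1. *)
Lemma proper_int (w : int -> int) :
  (forall k, 0 <= w k) -> (forall k, `|k| <= w k + 1) -> proper_weight w.
Proof.
move=> w0 wk; split=> // n.
exists ([seq Posz i | i <- iota 0 n.+2] ++ [seq - Posz i | i <- iota 0 n.+2]).
move=> k wkn; rewrite mem_cat; apply/orP.
case: (lerP 0 k) => k0; [left|right]; apply/mapP; exists `|k|%N;
  rewrite ?mem_iota; have := wk k; lia.
Qed.

Lemma proper_nat (w : nat -> int) : (forall k : nat, k%:Z <= w k) ->
  proper_weight w.
Proof.
move=> wk; split=> [k|n]; first by apply: le_trans (wk k).
by exists (iota 0 n.+1) => k kn; rewrite mem_iota; have := wk k; lia.
Qed.

End GeneratingFunctions.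

(** * Dissections of the theta series *)

Lemma fps_sum_gf (I : choiceType) (w : I -> int) : (forall k, 0 <= w k) ->
  fps_sum (fun k => 'q ^ w k) = gf w.
Proof.
move=> w0; apply/fpsP => n /=; apply: eq_fsbigr => k _.
have [a wk] : exists a : nat, w k = a by exists `|w k|%N; rewrite gez0_abs.
by rewrite wk -exprnP fps_coefXn eqz_nat eq_sym.
Qed.

Lemma gf_sign (w : int -> int) : proper_weight w ->
  gf w = gf (fun n : nat => w n%:Z) + gf (fun n : nat => w (- n%:Z - 1)).
Proof.
move=> wP; apply: (gf_split (f := Posz) (g := fun n : nat => - n%:Z - 1)) => //.
- by move=> a b [].
- by move=> a b; lia.
- by move=> a b; lia.
by case=> i; [left|right]; exists i; rewrite // NegzE; lia.
Qed.

(** The reflection k |-> - k - 1 exchanges the nonnegative and the negative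
    integers, which therefore contribute equally. *)
Lemma gf_symmetric (w : int -> int) : proper_weight w ->
  (forall k, w (- k - 1) = w k) -> gf w = gf (fun n : nat => w n%:Z) *+ 2.
Proof.
by move=> wP ws; rewrite gf_sign // mulr2n; congr (_ + _); apply: eq_gf => n.
Qed.

Lemma gf_parity (w : int -> int) (r : int) : `|r| = 1 -> proper_weight w ->
  gf w = gf (fun k => w (2 * k)) + gf (fun k => w (2 * k + r)).
Proof.
move=> r1 wP; apply: (gf_split (f := fun k => 2 * k) (g := fun k => 2 * k + r)).
- by [].
- by move=> a b; lia.
- by move=> a b; lia.
- by move=> a b; lia.
move=> i; have : i = 2 * (i %/ 2)%Z \/ i = 2 * ((i - r) %/ 2)%Z + r by lia.
by case=> ->; [left|right]; eexists.
Qed.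

Lemma gf_natS (w : nat -> int) : proper_weight w ->
  gf w = gf (fun _ : unit => w 0%N) + gf (fun n => w n.+1).
Proof.
move=> wP; apply: (gf_split (f := fun _ : unit => 0%N) (g := S)) => //.
- by move=> [] [].
- by move=> a b [].
by case=> [|n]; [left; exists tt|right; exists n].
Qed.

Lemma ler_abs_sqr (k : int) : `|k| <= k ^+ 2.
Proof. nia. Qed.

Lemma proper_sqr : proper_weight (fun k : int => k ^+ 2).
Proof.
apply: proper_int => k; first by rewrite sqr_ge0.
by have := ler_abs_sqr k; lia.
Qed.

Lemma phi_gf : phi_series = gf (fun k : int => k ^+ 2).
Proof. by apply: fps_sum_gf => k; rewrite sqr_ge0. Qed.

Lemma psi1_gf : psi1_series = gf (fun k : int => 4 * k ^+ 2 + k).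
Proof. by apply: fps_sum_gf => k; have := ler_abs_sqr k; lia. Qed.

Lemma psi2_gf : psi2_series = gf (fun k : int => 4 * k ^+ 2 - 3 * k).
Proof. by apply: fps_sum_gf => k; have := ler_abs_sqr k; lia. Qed.

Definition triangular (n : nat) : int := ((n ^ 2 + n) %/ 2)%N.

Lemma triangularE n : 2 * triangular n = n%:Z ^+ 2 + n%:Z.
Proof.
rewrite /triangular -[2]/(2%:Z) -PoszM mulnC divnK; last first.
  by rewrite dvdn2 oddD oddX /= addbb.
by rewrite PoszD -rmorphXn.
Qed.

Lemma proper_triangular : proper_weight triangular.
Proof. by apply: proper_nat => k; have := triangularE k; nia. Qed.

Lemma psi_gf : psi_series = gf triangular.
Proof.
rewrite -fps_sum_gf; last by move=> k; have [] := proper_triangular.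
by [].
Qed.

(** The triangular numbers of even rank 2k and of odd rank 2k - 1 are the
    values of the single form 2k^2 + k at k and - k: this makes psi a theta
    series over all integers, to be dissected by parity. *)
Lemma psi_gf_int : psi_series = gf (fun k : int => 2 * k ^+ 2 + k).
Proof.
rewrite psi_gf (@gf_bij _ _ _ (fun k : int => if 0 <= k then absz (2 * k)
  else absz (2 * k + 1))); last first.
  (* Nonnegative k encode even ranks and negative k odd ranks. *)
  exists (fun n => if odd n then - (n./2)%:Z - 1 else (n./2)%:Z).
    by move=> k; case: (lerP 0 k) => k0; case: ifP => odd_k; lia.
  by move=> n; case: (boolP (odd n)) => /= odd_n; [case: ifP => n0|]; lia.
apply: eq_gf => k /=; apply: (@mulfI int 2) => //; rewrite triangularE.
by case: (lerP 0 k) => k0; nia.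
Qed.

(** k^2 + k is twice a triangular number, and each triangular number arises
    from the two integers k and - k - 1. *)
Lemma gf_oblong c :
  gf (fun k : int => c.+1%:Z * (k ^+ 2 + k)) = dilate (2 * c.+1) psi_series *+
    2.
Proof.
rewrite -dilate_gf gf_symmetric; last 2 first.
- by apply: proper_int => k; have := ler_abs_sqr k; nia.
- by move=> k; ring.
rewrite raddfMn psi_gf -dilate_dilate dilate_gf; congr (dilate _ _ *+ 2).
by apply: eq_gf => n; rewrite triangularE.
Qed.

(** Even squares are 4 k^2, odd squares are 4 (k^2 + k) + 1. *)
Lemma phi_dissection :
  phi_series = dilate 4 phi_series + 2 * 'q * dilate 8 psi_series.
Proof.
have ob0 k : 0 <= 4%:Z * (k ^+ 2 + k) by have := ler_abs_sqr k; lia.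
rewrite {1}phi_gf (@gf_parity _ 1) //; last exact: proper_sqr.
have -> : 2 * 'q * dilate 8 psi_series = 'q ^+ 1 * (dilate 8 psi_series *+ 2).
  by ring.
rewrite -(gf_oblong 3) mulXn_gf // phi_gf dilate_gf; congr (_ + _);
  by apply: eq_gf => k; ring.
Qed.

(** Splitting 2k^2 + k according to parity: k = 2j gives 2 (4j^2 + j), and k =
    2j - 1 gives 2 (4j^2 - 3j) + 1. *)
Lemma psi_dissection :
  psi_series = dilate 2 psi1_series + 'q * dilate 2 psi2_series.
Proof.
rewrite psi_gf_int (@gf_parity _ (-1)) //; last first.
  by apply: proper_int => k; have := ler_abs_sqr k; lia.
rewrite psi1_gf psi2_gf !dilate_gf -['q]expr1 mulXn_gf; last first.
  by move=> k; have := ler_abs_sqr k; lia.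
by congr (_ + _); apply: eq_gf => k; ring.
Qed.

Lemma rotate_parity (x y : int) : exists m n : int,
  (x = m + n /\ y = m - n) \/ (x = m + n + 1 /\ y = m - n).
Proof.
pose m := divz (x + y) 2.
have [xy|xy] : (x + y = 2 * m) \/ (x + y = 2 * m + 1) by rewrite /m; lia.
  by exists m, (x - m); lia.
by exists m, (x - m - 1); lia.
Qed.

(** Rotating the plane lattice: a pair (x, y) with x + y even is of the form
    (m+n, m-n), of weight 2m^2 + 2n^2, and one with x + y odd is of the form
    (m+n+1, m-n), of weight 1 + 2(m^2+m) + 2(n^2+n). *)
Lemma phi_sqr : phi_series ^+ 2 =
  dilate 2 phi_series ^+ 2 + 4 * 'q * dilate 4 psi_series ^+ 2.
Proof.
have sqrP := proper_sqr.
have sqr2P : proper_weight (fun k : int => 2%:Z * k ^+ 2).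
  by apply: proper_int => k; have := ler_abs_sqr k; lia.
have ob0 (k : int) : 0 <= 2%:Z * (k ^+ 2 + k) by have := ler_abs_sqr k; lia.
have obP : proper_weight (fun k : int => 2%:Z * (k ^+ 2 + k)).
  by apply: proper_int => // k; have := ler_abs_sqr k; have := sqr_ge0 (k + 1);
    nia.
have -> : 4 * 'q * dilate 4 psi_series ^+ 2 = 'q ^+ 1 * (dilate (2 * 2)
  psi_series *+ 2) ^+ 2.
  by ring.
rewrite -(gf_oblong 1) phi_gf dilate_gf !expr2 !gfM // mulXn_gf => [|p];
  last first.
  by rewrite addr_ge0.
rewrite (gf_split (f := fun p : int * int => (p.1 + p.2, p.1 - p.2))
                  (g := fun p : int * int => (p.1 + p.2 + 1, p.1 - p.2))).
- by congr (_ + _); apply: eq_gf => -[m n] /=; ring.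
- exact: (proper_pair sqrP sqrP).
- by move=> [m n] [m' n'] [/= e1 e2]; congr pair; lia.
- by move=> [m n] [m' n'] [/= e1 e2]; congr pair; lia.
- by move=> [m n] [m' n'] [/= e1 e2]; lia.
by move=> [x y]; have [m [n [[-> ->]|[-> ->]]]] := rotate_parity x y;
  [left|right]; exists (m, n).
Qed.

Lemma phi_gf_nat : phi_series = 1 + gf (fun n : nat => n.+1%:Z ^+ 2) *+ 2.
Proof.
have sqrP := proper_sqr.
rewrite phi_gf gf_sign // gf_natS; last first.
  by apply: proper_nat => k; have := ler_abs_sqr k; lia.
rewrite -gf_unit -addrA mulr2n; congr (_ + (_ + _)); apply: eq_gf => n //.
by rewrite -sqrrN; congr (_ ^+ 2); lia.
Qed.

(** Pairs of distinct indices come in couples (x, y), (y, x) of equal weight,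
    so that only the diagonal survives modulo 2. *)
Lemma psi_sqr_mod2 :
  exists g, psi_series ^+ 2 = dilate 2 psi_series + g *+ 2.
Proof.
have tP := proper_triangular.
(* The pair p holds the smaller of two distinct indices and their difference
   minus one; b tells which index is the smaller. *)
pose v b (p : nat * nat) :=
  if b then (p.1, p.1 + p.2 + 1)%N else (p.1 + p.2 + 1, p.1)%N.
pose w (p : nat * nat) := triangular p.1 + triangular p.2.
exists (gf (w \o v true)).
have v_inj : injective (fun x : bool * (nat * nat) => v x.1 x.2).
  by move=> [[] [m n]] [[] [m' n']] [/= e1 e2]; do ?congr pair; lia.
rewrite psi_gf dilate_gf expr2 gfM //.
rewrite (gf_split (f := fun n : nat => (n, n))
  (g := fun x : bool * (nat * nat) => v x.1 x.2)).
- congr (_ + _); first by apply: eq_gf => n /=; ring.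
  rewrite (gf_split (f := pair true) (g := pair false)).
  + rewrite mulr2n; congr (_ + _); apply: eq_gf => p /=.
    by rewrite addrC.
  + exact: (proper_comp v_inj (proper_pair tP tP)).
  + by move=> p p' [].
  + by move=> p p' [].
  + by [].
  by move=> [[] p]; [left|right]; exists p.
- exact: (proper_pair tP tP).
- by move=> n n' [].
- exact: v_inj.
- by move=> n [[] [m' n']] [/= e1 e2]; lia.
move=> [x y]; case: (ltngtP x y) => xy.
- by right; exists (true, (x, y - x - 1)%N); rewrite /v /=; congr pair; lia.
- by right; exists (false, (y, x - y - 1)%N); rewrite /v /=; congr pair; lia.
by left; exists x; rewrite xy.
Qed.

(** * Overpartitions as coloured lists *)

(** The order on parts that makes overpartitions the decreasing lists: a
    repeated part must not be overlined again. *)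
Definition may_follow (x y : nat * bool) : bool :=
  (y.1 < x.1)%N || (y.1 == x.1) && ~~ y.2.

Definition parts_sum (s : seq (nat * bool)) : nat := sumn [seq x.1 | x <- s].

Definition overpartition_upto (N : nat) (s : seq (nat * bool)) : bool :=
  pairwise may_follow s && all (fun x => 0 < x.1 <= N)%N s.

(** Both conditions on a list, that the parts decrease and that overlines sit
    on first occurrences, are pairwise conditions; together they say that any
    later part may follow any earlier one. *)
Lemma is_overpartitionE n s : is_overpartition n s =
  [&& pairwise may_follow s, all (fun x => 0 < x.1)%N s & parts_sum s == n].
Proof.
rewrite /is_overpartition /parts_sum all_map.
have -> : [forall i : 'I_(size s), (nth (0%N, false) s i).2 ==>
    ((nth (0%N, false) s i).1 \notin take i [seq x.1 | x <- s])] =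
    pairwise [rel x y | y.2 ==> (y.1 != x.1)] s.
  apply/forallP/(pairwiseP (0%N, false)) => [unm i j i_s j_s ij | rel_s i].
    have := unm (Ordinal j_s) => /=; case: (nth _ s j).2 => //=.
    apply: contra => /eqP->; apply/(nthP 0%N); exists i.
      by rewrite size_takel ?size_map // ltnW.
    by rewrite nth_take // (nth_map (0%N, false)).
  apply/implyP => over_i; apply/negP => /(nthP 0%N)[j].
  have i_s := ltn_ord i.
  rewrite size_takel ?size_map ?(ltnW i_s) // => ji;
    have j_s := ltn_trans ji i_s.
  rewrite nth_take // (nth_map (0%N, false)) // => ij.
  by have := rel_s j i j_s i_s ji; rewrite /= over_i ij eqxx.
rewrite sorted_pairwise; last by move=> y x z /=; lia.
have -> : pairwise may_follow s = pairwise geq [seq x.1 | x <- s] &&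
    pairwise [rel x y | y.2 ==> (y.1 != x.1)] s.
  rewrite pairwise_map -pairwise_relI; apply: eq_pairwise => -[k b] [l c].
  by rewrite /may_follow /=; case: ltngtP; case: c.
by rewrite -!andbA; congr (_ && _); rewrite andbA andbC.
Qed.

Lemma overpartition_upto_cons N x s :
  overpartition_upto N (x :: s) =
  [&& (0 < x.1 <= N)%N, all (may_follow x) s & overpartition_upto N s].
Proof.
rewrite /overpartition_upto /=.
by rewrite andbACA (andbC (all _ _)) -andbA.
Qed.

Lemma overpartition_upto_lower N M s : (forall x, x \in s -> (x.1 <= N)%N) ->
  overpartition_upto M s -> overpartition_upto N s.
Proof.
move=> s_le /andP[s_rel /allP s_pos]; apply/andP; split=> //;
  apply/allP => x xs.
by have /andP[-> _] := s_pos x xs; apply: s_le.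
Qed.

Lemma overpartition_upto_le N s x :
  overpartition_upto N s -> x \in s -> (x.1 <= N)%N.
Proof. by move=> /andP[_ /allP s_le] /s_le/andP[]. Qed.

Lemma overpartition_uptoS N s :
  overpartition_upto N s -> overpartition_upto N.+1 s.
Proof.
move=> sP; apply: (overpartition_upto_lower _ sP) => x.
by move/(overpartition_upto_le sP)/leqW.
Qed.

Lemma overpartition_upto_cons_over N s :
  overpartition_upto N s -> overpartition_upto N.+1 ((N.+1, true) :: s).
Proof.
move=> sP; rewrite overpartition_upto_cons /= leqnn overpartition_uptoS //
  andbT.
apply/allP => x /(overpartition_upto_le sP) x_le.
by rewrite /may_follow /= ltnS x_le.
Qed.

(** Adds one non-overlined part a to a list with parts at most a. If the list
    starts with an overlined a, that part has to stay in front. *)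
Definition add_part (a : nat) (s : seq (nat * bool)) : seq (nat * bool) :=
  if s is (k, true) :: t then
    if k == a then [:: (a, true), (a, false) & t] else (a, false) :: s
  else (a, false) :: s.

Lemma parts_sum_add_part a s : parts_sum (add_part a s) = (a + parts_sum s)%N.
Proof. by case: s => [|[k []] t] //=; case: eqP => // ->. Qed.

Lemma add_part_inj a : injective (add_part a).
Proof.
by case=> [|[k []] s] [|[k' []] s'] //=; do ?[case: eqP => // ?];
  case=> *; subst.
Qed.

Lemma overpartition_upto_add_part N s :
  overpartition_upto N.+1 s -> overpartition_upto N.+1 (add_part N.+1 s).
Proof.
have add_front k b t : overpartition_upto N.+1 ((k, b) :: t) ->
    (k != N.+1) || ~~ b ->
    overpartition_upto N.+1 ((N.+1, false) :: (k, b) :: t).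
  move=> sP kb; rewrite overpartition_upto_cons sP /= leqnn !andbT.
  move: sP; rewrite overpartition_upto_cons => /and3P[/= /andP[_ k_le] /allP tk
    _].
  apply/andP; split; first by rewrite /may_follow /=; lia.
  by apply/allP => x /tk; rewrite /may_follow /=; case: x.2; lia.
case: s => [|[k []] t] /=; first by rewrite overpartition_upto_cons /= leqnn.
  case: eqP => [->|/eqP kN] sP; last by rewrite add_front ?kN.
  move: sP; rewrite !overpartition_upto_cons /= leqnn /= => /andP[tk ->].
  have tk' : all (may_follow (N.+1, false)) t := tk.
  by rewrite tk ?tk' /may_follow /= eqxx orbT.
by move=> sP; rewrite add_front ?orbT.
Qed.

(** The decomposition behind the factor (1 + q^a) / (1 - q^a) of the
    generating function, with a = N + 1. When a is the largest part, either a
    occurs once and is overlined, or one non-overlined copy of a can be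
    removed. *)
Lemma overpartition_uptoS_cases N s : overpartition_upto N.+1 s ->
  [\/ overpartition_upto N s,
      exists2 t, overpartition_upto N t & s = (N.+1, true) :: t |
      exists2 t, overpartition_upto N.+1 t & s = add_part N.+1 t].
Proof.
case: s => [|[k b] t]; first by constructor 1.
move=> sP; have s_le x := @overpartition_upto_le _ _ x sP.
move: sP; rewrite overpartition_upto_cons => /and3P[/= /andP[k_gt0 k_le] tk tP].
have t_le x : x \in t -> (x.1 <= k)%N.
  by move/(allP tk); rewrite /may_follow /=; lia.
have [k_leN|k_gtN] := leqP k N.
  constructor 1; rewrite overpartition_upto_cons /= k_gt0 k_leN tk /=.
  by apply: overpartition_upto_lower tP => x /t_le/leq_trans; apply.
have {k_le k_gtN} kN : k = N.+1 by lia.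
rewrite {k}kN in k_gt0 tk t_le s_le *; case: b tk s_le => tk s_le; last first.
  constructor 3; exists t => //; case: t tk {tP t_le s_le} => [|[k []] t] //=.
  by case: eqP => // -> /andP[]; rewrite /may_follow /= ltnn andbF.
case: t tk tP t_le {s_le} => [|[k b] t] tk tP t_le.
  by constructor 2; exists [::].
have := t_le _ (mem_head _ _); rewrite leq_eqVlt /= => /orP[/eqP kN|k_lt].
  rewrite {}kN in tk tP t_le *; move: tk => /= /andP[];
    rewrite /may_follow /= ltnn eqxx /=.
  case: b tP t_le => // tP t_le _ tk; constructor 3;
    exists ((N.+1, true) :: t); last by rewrite /add_part eqxx.
  by move: tP; rewrite !overpartition_upto_cons.
constructor 2; exists ((k, b) :: t) => //.
apply: overpartition_upto_lower (tP) => x; rewrite inE => /orP[/eqP->//|xt].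
move: tP; rewrite overpartition_upto_cons => /and3P[_ /allP/(_ x xt) /= kx _].
by move: kx; rewrite /may_follow /=; lia.
Qed.

(** * Overpartitions with bounded parts *)

Definition overpartition (N : nat) := {s | overpartition_upto N s}.

(** The lists over which overpartitions are counted, with bounded integers
    replaced by natural numbers so that they can be compared for different
    bounds. *)
Definition bounded_lists (n N : nat) : seq (seq (nat * bool)) :=
  [seq [seq (val x.1, x.2) | x <- val s] | s : n.-bseq ('I_N.+1 * bool)].

Lemma mem_bounded_lists n N s : (size s <= n)%N ->
  (forall x, x \in s -> (x.1 <= N)%N) -> s \in bounded_lists n N.
Proof.
move=> s_n s_N; have t_n : (size [seq (inord x.1 : 'I_N.+1, x.2) | x <- s] <=
  n)%N.
  by rewrite size_map.
apply/mapP; exists (Bseq t_n); first by rewrite mem_enum.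
rewrite /= -map_comp -[LHS]map_id; apply/eq_in_map => -[k b] /s_N /= k_N.
by rewrite inordK.
Qed.

Lemma bounded_lists_uniq n N : uniq (bounded_lists n N).
Proof.
rewrite map_inj_uniq ?enum_uniq // => s t st; apply: val_inj.
by apply: (inj_map _ st) => -[i b] [j c] [/val_inj-> ->].
Qed.

Lemma parts_sum_ge x s : x \in s -> (x.1 <= parts_sum s)%N.
Proof.
elim: s => //= y s IHs; rewrite inE => /orP[/eqP->|/IHs]; rewrite /parts_sum /=.
  exact: leq_addr.
by move/leq_trans; apply; apply: leq_addl.
Qed.

Lemma size_parts_sum s : all (fun x => 0 < x.1)%N s ->
  (size s <= parts_sum s)%N.
Proof.
elim: s => //= x s IHs /andP[x_gt0 /IHs s_le]; rewrite /parts_sum /= -add1n.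
exact: leq_add.
Qed.

Lemma overpartition_upto_gt0 N s :
  overpartition_upto N s -> all (fun x => 0 < x.1)%N s.
Proof. by move=> /andP[_]; apply: sub_all => x /andP[]. Qed.

Definition overpartition_weight N (s : overpartition N) : int :=
  parts_sum (val s).

Lemma proper_overpartition N : proper_weight (@overpartition_weight N).
Proof.
split=> // n; exists (pmap insub (bounded_lists n N)) => s;
  rewrite lez_nat => s_n.
rewrite mem_pmap_sub /=; apply: mem_bounded_lists.
  apply: leq_trans s_n; apply: size_parts_sum.
  exact: overpartition_upto_gt0 (valP s).
by move=> x; apply: overpartition_upto_le (valP s).
Qed.

Definition overp_upto_series (N : nat) : fps int :=
  gf (@overpartition_weight N).

(** No part of an overpartition of n exceeds n, so bounding the parts by any N
    >= n changes nothing. *)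
Lemma overp_upto_seriesE N n : (n <= N)%N -> overp_upto_series N n = overp n.
Proof.
move=> n_N; rewrite /overp_upto_series.
have insub_uniq : uniq (pmap (insub : _ ->
  option (overpartition N)) (bounded_lists n n)).
  exact/pmap_sub_uniq/bounded_lists_uniq.
rewrite (gf_seq insub_uniq); last first.
  move=> s [s_n]; rewrite mem_pmap_sub /=; apply: mem_bounded_lists.
    rewrite -s_n; apply: size_parts_sum.
    exact: overpartition_upto_gt0 (valP s).
  by move=> x; rewrite -s_n; apply: parts_sum_ge.
have -> : overp n = (\sum_(t : n.-bseq ('I_n.+1 * bool))
    is_overpartition n [seq (val x.1, x.2) | x <- t])%N.
  by rewrite /overp -sum1dep_card big_mkcond; apply: eq_bigr => t _; case: ifP.
rewrite big_pmap big_map big_enum -[RHS]natz natr_sum; apply: eq_bigr => t _.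
case: insubP => [u _ uE|not_N] /=.
  rewrite /overpartition_weight is_overpartitionE uE eqz_nat.
  have := valP u; rewrite uE => tP; rewrite (overpartition_upto_gt0 tP).
  by move: tP => /andP[-> _].
rewrite is_overpartitionE; case: and3P => // -[t_rel t_gt0 /eqP t_n].
case/negP: not_N; apply/andP; split=> //; apply/allP => x xt.
by rewrite (allP t_gt0 _ xt) (leq_trans _ n_N) // -t_n parts_sum_ge.
Qed.

Lemma overp_upto_series0 : overp_upto_series 0 = 1.
Proof.
rewrite -gf_unit /overp_upto_series.
have nilP : overpartition_upto 0 [::] by [].
rewrite (@gf_bij _ unit _ (fun=> exist _ [::] nilP)) //.
exists (fun=> tt) => [[]|] // [s sP]; apply: val_inj => /=.
by case: s sP => // x s; rewrite overpartition_upto_cons; case: x.1.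
Qed.

(** This is Q_(N+1) (1 - q^(N+1)) = Q_N (1 + q^(N+1)), in the subtraction-free
    form that results from [overpartition_uptoS_cases]. *)
Lemma overp_upto_seriesS N : overp_upto_series N.+1 =
  overp_upto_series N + 'q ^+ N.+1 * (overp_upto_series N + overp_upto_series
    N.+1).
Proof.
pose f (s : overpartition N) : overpartition N.+1 :=
  exist _ (val s) (overpartition_uptoS (valP s)).
pose g1 (s : overpartition N) : overpartition N.+1 :=
  exist _ ((N.+1, true) :: val s) (overpartition_upto_cons_over (valP s)).
pose g2 (s : overpartition N.+1) : overpartition N.+1 :=
  exist _ (add_part N.+1 (val s)) (overpartition_upto_add_part (valP s)).
pose g (x : overpartition N + overpartition N.+1) :=
  match x with inl s => g1 s | inr s => g2 s end.
have f_inj : injective f by move=> s t /(congr1 val) st; apply: val_inj.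
have top_notin (s : overpartition N) b : (N.+1, b) \notin val s.
  by apply/negP => /(overpartition_upto_le (valP s)) /=; rewrite ltnn.
have g1_g2 s t : g1 s <> g2 t.
  move/(congr1 val) => /=; case: (val t) => [|[k []] u] //=.
  case: eqP => // _ [s_u]; have := top_notin s false.
  by rewrite /= s_u mem_head.
have g_inj : injective g.
  case=> [s|s] [t|t] /= st; last 1 first.
  - by move: st => /(congr1 val) /add_part_inj st; congr inr; apply: val_inj.
  - by move: st => /(congr1 val) [st]; congr inl; apply: val_inj.
  - by case: (g1_g2 _ _ st).
  - by case: (g1_g2 t s).
have wP := @proper_overpartition N.+1.
rewrite mulrDr {1}/overp_upto_series (gf_split (f := f) (g := g)) //;
  last 2 first.
- move=> s [t|t] /(congr1 val) /= st; have := top_notin s.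
    by move/(_ true); rewrite /= st mem_head.
  move/(_ false) => /=; rewrite st; case: (val t) => [|[k []] u] /=;
    rewrite ?mem_head //; case: eqP => //; rewrite ?inE ?eqxx ?orbT //.
- move=> [s sP]; have [s_N|[t tP sE]|[t tP sE]] := overpartition_uptoS_cases sP.
  + by left; exists (exist _ s s_N); apply: val_inj.
  + by right; exists (inl (exist _ t tP)); apply: val_inj.
  + by right; exists (inr (exist _ t tP)); apply: val_inj.
congr (_ + _); rewrite (gf_split (f := inl) (g := inr)) //.
- rewrite !mulXn_gf //; congr (_ + _); apply: eq_gf => s /=.
  by rewrite /overpartition_weight /= parts_sum_add_part PoszD.
- exact: proper_comp.
- by move=> s t [].
- by move=> s t [].
by case=> s; [left|right]; exists s.
Qed.

(** * Gauss's theorem and the overpartition series *)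

(** Q_n is to be thought of as the product of the (1 + x^i) / (1 - x^i) for i
    <= n, and B_n as Q_n / (1 - x^(n+1)), which counts the overpartitions with
    parts at most n + 1 where n + 1 is never overlined. *)
Section PartialTheta.
Variables (R : comUnitRingType) (x : R) (Q B : nat -> R).
Hypothesis x_unit : forall n, 1 - x ^+ n.+1 \is a GRing.unit.
Hypothesis Q0 : Q 0 = 1.
Hypothesis QS : forall n, Q n.+1 * (1 - x ^+ n.+1) = Q n * (1 + x ^+ n.+1).
Hypothesis BE : forall n, B n * (1 - x ^+ n.+1) = Q n.

Definition partial_theta (n : nat) : R :=
  1 + (\sum_(k < n) (-1) ^+ k.+1 * x ^+ (k.+1 ^ 2)) *+ 2.

(* The remainder Q_n S_n - 1, with x^(n+1) replaced by a free variable y: this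
   freedom is what makes the sum telescope. *)
Let U (n : nat) (y : R) : R :=
  (\sum_(k < n) (-1) ^+ k.+1 * B k * y ^+ k.+1) *+ 2.

Lemma B_succ n : B n * (1 + x ^+ n.+1) = Q n.+1.
Proof. by apply: (mulIr (x_unit n)); rewrite QS mulrAC BE. Qed.

(** Each term of the left-hand side contains (1-y)x^(k+1) - (1+y) =
    -(1-x^(k+1)) - y(1+x^(k+1)), and B_k turns the two factors into Q_k and
    Q_(k+1): the terms are differences of consecutive values of 2 (-1)^k
    y^(k+1) Q_k. *)
Lemma tail_telescope n y :
  (1 - y) * U n (y * x) - (1 + y) * U n y =
  2 * y - 2 * (-1) ^+ n * y ^+ n.+1 * Q n.
Proof.
rewrite /U; elim: n => [|n IHn]; first by rewrite !big_ord0 Q0; ring.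
rewrite !big_ord_recr /=; set a := \sum_(k < n) _; set b := \sum_(k < n) _.
rewrite -/a -/b in IHn.
have regroup (a' b' : R) : (1 - y) * ((a + a') *+ 2) - (1 + y) * ((b + b') *+
  2) =
    ((1 - y) * (a *+ 2) - (1 + y) * (b *+ 2)) +
    ((1 - y) * (a' *+ 2) - (1 + y) * (b' *+ 2)) by ring.
rewrite regroup IHn -(B_succ n) -(BE n) exprMn !exprS; ring.
Qed.

(** Passing from n to n + 1 multiplies Q_n by (1 + x^(n+1)) / (1 - x^(n+1))
    and adds one term to the partial sum; [tail_telescope] at y = x^(n+1)
    shows that the remainder changes accordingly. *)
Lemma partial_theta_tail n :
  Q n * partial_theta n = 1 + U n (x ^+ n.+1).
Proof.
elim: n => [|n IHn].
  by rewrite /partial_theta /U !big_ord0 Q0; ring.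
apply: (mulrI (x_unit n)); have tele := tail_telescope n (x ^+ n.+1).
set X := x ^+ n.+1 in IHn tele *.
have -> : partial_theta n.+1 = partial_theta n + 2 * (-1) ^+ n.+1 * X ^+ n.+1.
  rewrite /partial_theta big_ord_recr /= mulrnDl addrA -exprM mulnn.
  by congr (_ + _); ring.
have -> : U n.+1 (x ^+ n.+2) =
    U n (X * x) + 2 * (-1) ^+ n.+1 * B n * (X * X ^+ n.+1).
  rewrite /U big_ord_recr /= mulrnDl -exprSr; congr (_ + _).
  by rewrite -exprS -!exprM mulnC; ring.
have QX : (1 - X) * Q n.+1 = (1 + X) * Q n by rewrite mulrC [RHS]mulrC;
  apply: QS.
have BX : (1 - X) * B n = Q n by rewrite mulrC; apply: BE.
have {IHn} QP : (1 - X) * (Q n.+1 * partial_theta n) = (1 + X) * (1 + U n X).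
  by rewrite -IHn !mulrA QX.
transitivity ((1 - X) * (Q n.+1 * partial_theta n)
  + (1 - X) * Q n.+1 * (2 * (-1) ^+ n.+1 * X ^+ n.+1)); first by ring.
rewrite QP QX; transitivity ((1 - X)
  + ((1 - X) * U n (X * x) - (1 + X) * U n X) + (1 + X) * U n X
  + 2 * (-1) ^+ n.+1 * (X * X ^+ n.+1) * ((1 - X) * B n)); last by ring.
by rewrite BX tele !exprS; ring.
Qed.

Lemma partial_theta_tail_divisible n :
  exists t, Q n * partial_theta n = 1 + x ^+ n.+1 * t.
Proof.
exists ((\sum_(k < n) (-1) ^+ k.+1 * B k * (x ^+ n.+1) ^+ k) *+ 2).
rewrite partial_theta_tail /U mulrnAr mulr_sumr; congr (_ + _ *+ 2).
by apply: eq_bigr => k _; rewrite mulrCA -[in RHS]exprS.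
Qed.

End PartialTheta.

Lemma one_subXn_unit n : 1 - 'q ^+ n.+1 \is a GRing.unit.
Proof. by apply: fps_unit1; rewrite fps_coefD fps_coefN fps_coefXn. Qed.

Lemma overp_upto_series_theta n :
  exists t, overp_upto_series n * partial_theta 'q n = 1 + 'q ^+ n.+1 * t.
Proof.
apply: (@partial_theta_tail_divisible _ _ _
  (fun k => overp_upto_series k / (1 - 'q ^+ k.+1))).
- exact: one_subXn_unit.
- exact: overp_upto_series0.
- by move=> k; rewrite mulrBr mulr1 {1}overp_upto_seriesS; ring.
by move=> k; rewrite divrK // one_subXn_unit.
Qed.

Lemma fps_coef_signM (f : fps int) m n : ((-1) ^+ m * f) n = (-1) ^+ m * f n.
Proof.
by elim: m => [|m IHm]; rewrite ?mul1r // !exprS -!mulrA !mulN1r fps_coefN IHm.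
Qed.

Lemma alternate_phi_partial n i : (i <= n)%N ->
  alternate phi_series i = partial_theta 'q n i.
Proof.
move=> i_n; have squares : alternate (gf (fun k : nat => k.+1%:Z ^+ 2)) i =
    (\sum_(k < n) (-1) ^+ k.+1 * 'q ^+ (k.+1 ^ 2)) i.
  have -> (f : fps int) : alternate f i = (-1) ^+ i * f i by [].
  rewrite (@gf_seq _ _ _ (iota 0 n)) ?iota_uniq //; last first.
    by move=> k; rewrite mem_iota; nia.
  rewrite fps_coef_sum mulr_sumr -{1}[n]subn0 big_mkord; apply: eq_bigr => k _.
  rewrite fps_coef_signM fps_coefXn.
  rewrite expr2 -PoszM mulnn eqz_nat eq_sym; case: eqP => [->|];
    last by rewrite !mulr0.
  by rewrite -signr_odd oddX -[in RHS]signr_odd.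
rewrite phi_gf_nat /partial_theta !mulr2n !rmorphD rmorph1.
by rewrite !fps_coefD squares.
Qed.

(** The coefficient of q^n only involves coefficients up to n, where the two
    series agree with Q_n and with the n-th partial sum. *)
Lemma overp_alternate_phi : overp_series * alternate phi_series = 1.
Proof.
apply/fpsP => n; have [t Qtheta] := overp_upto_series_theta n.
transitivity ((overp_upto_series n * partial_theta 'q n) n).
  rewrite !fps_coefM; apply: eq_bigr => i _.
  by rewrite (overp_upto_seriesE (leq_ord i)) (alternate_phi_partial (leq_subr
    i n)).
by rewrite Qtheta fps_coefD fps_coefXnM ltnn addr0.
Qed.

(** By [phi_dissection], phi(q) and phi(-q) are phi(q^4) +- 2 q psi(q^8),
    whose product is phi(q^4)^2 - 4 q^2 psi(q^8)^2; by [phi_sqr] at - q^2 this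
    is phi(-q^2)^2. *)
Lemma phi_mul_alternate :
  phi_series * alternate phi_series = dilate 2 (alternate phi_series) ^+ 2.
Proof.
have -> : dilate 2 (alternate phi_series) ^+ 2 =
    dilate 4 phi_series ^+ 2 - 4 * 'q ^+ 2 * dilate 8 psi_series ^+ 2.
  rewrite -rmorphXn -rmorphXn phi_sqr rmorphD rmorphD /=.
  rewrite !(rmorphM, rmorphXn, rmorph_nat) /= alternateX !alternate_dilate //.
  by rewrite [dilate 2 (- _)]raddfN /= dilateX !dilate_dilate; ring.
have -> : alternate phi_series =
    dilate 4 phi_series - 2 * 'q * dilate 8 psi_series.
  rewrite {1}phi_dissection rmorphD !rmorphM rmorph_nat /= alternateX.
  by rewrite !alternate_dilate //; ring.
by rewrite {1}phi_dissection; ring.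
Qed.

Lemma phi_mul_alternate_dilate m : dilate m.+1 phi_series * dilate m.+1
  (alternate phi_series) =
  dilate (2 * m.+1) (alternate phi_series) ^+ 2.
Proof. by rewrite -rmorphM phi_mul_alternate rmorphXn /= dilate_dilate. Qed.

(** Four applications of [phi_mul_alternate], at q, q^2, q^4 and q^8, to the
    inverse 1 / phi(-q) given by [overp_alternate_phi]. *)
Lemma overp_series_phi16 :
  overp_series * dilate 16 (alternate phi_series) ^+ 16 =
  phi_series * dilate 2 phi_series ^+ 2 * dilate 4 phi_series ^+ 4
  * dilate 8 phi_series ^+ 8.
Proof.
have d2 := phi_mul_alternate; have d4 := phi_mul_alternate_dilate 1.
have d8 := phi_mul_alternate_dilate 3; have d16 := phi_mul_alternate_dilate 7.
rewrite /= in d4 d8 d16.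
have -> : dilate 16 (alternate phi_series) ^+ 16 =
  (dilate (2 * 8) (alternate phi_series) ^+ 2) ^+ 8 by rewrite -exprM.
rewrite -d16 exprMn.
have -> : dilate 8 (alternate phi_series) ^+ 8 =
  (dilate (2 * 4) (alternate phi_series) ^+ 2) ^+ 4 by rewrite -exprM.
rewrite -d8 exprMn.
have -> : dilate 4 (alternate phi_series) ^+ 4 =
  (dilate (2 * 2) (alternate phi_series) ^+ 2) ^+ 2 by rewrite -exprM.
rewrite -d4 exprMn -d2.
rewrite -[RHS]mul1r -overp_alternate_phi; ring.
Qed.

(** * The dissection modulo 16 *)

(** Here A, P, S, u, v stand for phi(q^16), psi(q^32), psi(q^16), psi_1(q^16)
    and psi_2(q^16). *)
Section Mod16.
Variables (R : comNzRingType) (q A P S u v t e : R).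
Hypothesis A_odd : A = 1 + 2 * t.
Hypothesis S_sqr : S ^+ 2 = P + 2 * e.

(* phi(q^4), psi(q^8) and phi(q) phi(q^2)^2 in terms of these variables. *)
Let a : R := A + 2 * q ^+ 4 * P.
Let T : R := u + q ^+ 8 * v.
Let cubic : R := (a + 2 * q * T) * (a ^+ 2 + 4 * q ^+ 2 * T ^+ 2).
(* Modulo 16, a^4 is A^4 + 8 A * correction. *)
Let correction : R := q ^+ 4 * A ^+ 2 * P + q ^+ 8 * A * P ^+ 2.

Definition dissection16 : R :=
  A ^+ 3
  - 2 * (4 * q ^+ 16 * P ^+ 2 * v + 7 * A ^+ 2 * u) * q
  + 4 * A * (q ^+ 16 * v ^+ 2 + u ^+ 2) * q ^+ 2
  + 8 * u * (q ^+ 16 * v ^+ 2 + u ^+ 2) * q ^+ 3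
  + 2 * A * (4 * S ^+ 2 + 3 * A * P) * q ^+ 4
  + 8 * A * P * u * q ^+ 5
  + 8 * P * (q ^+ 16 * v ^+ 2 + u ^+ 2) * q ^+ 6
  + 4 * A * P ^+ 2 * q ^+ 8
  - 2 * (7 * A ^+ 2 * v + 4 * P ^+ 2 * u) * q ^+ 9
  + 8 * A * u * v * q ^+ 10
  + 8 * v * (q ^+ 16 * v ^+ 2 + u ^+ 2) * q ^+ 11
  + 8 * P ^+ 3 * q ^+ 12
  + 8 * A * P * v * q ^+ 13.

Lemma cubic_mod2 : exists f, cubic = A ^+ 3 + 2 * f.
Proof.
pose y := q ^+ 4 * P + q * T.
pose k := 2 * A * q ^+ 4 * P + 2 * q ^+ 8 * P ^+ 2 + 2 * q ^+ 2 * T ^+ 2.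
exists (A * k + A ^+ 2 * y + 2 * y * k); rewrite /cubic /a /k /y.
move: T => T'; ring.
Qed.

Lemma pow4_mod16 : exists f, a ^+ 4 = A ^+ 4 + 8 * A * correction + 16 * f.
Proof.
pose y := q ^+ 4 * P; exists (A ^+ 2 * y ^+ 2 + 2 * A * y ^+ 3 + y ^+ 4).
by rewrite /a /correction /y; ring.
Qed.

Lemma pow8_mod16 : exists f,
  (A ^+ 2 + 4 * q ^+ 8 * P ^+ 2) ^+ 4 = A ^+ 8 + 16 * f.
Proof.
pose z := q ^+ 8 * P ^+ 2.
exists (A ^+ 6 * z + 6 * A ^+ 4 * z ^+ 2 + 16 * A ^+ 2 * z ^+ 3 + 16 * z ^+ 4).
by rewrite /z; ring.
Qed.

(** Apart from multiples of 16 that expansion makes visible, the two sides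
    differ by 8 q^4 (A^2 P - A S^2), and both products in the bracket are A P
    modulo 2. *)
Lemma cubic_dissection16 : exists g,
  cubic + 8 * correction = dissection16 + 16 * g.
Proof.
exists (q ^+ 4 * A * P * t - q ^+ 4 * A * e + q ^+ 8 * A * P ^+ 2
  + q * A ^+ 2 * u + q ^+ 9 * A ^+ 2 * v + q ^+ 9 * P ^+ 2 * u
  + q ^+ 17 * P ^+ 2 * v + q ^+ 14 * u * v * P + q ^+ 11 * u * v * T).
rewrite /cubic /correction /dissection16 S_sqr /a /T.
have -> : q ^+ 4 * A * P * t = q ^+ 4 * P * t * (1 + 2 * t) by rewrite A_odd;
  ring.
rewrite A_odd; ring.
Qed.

(** The correction comes with a factor 8, so the cubic next to it may be
    replaced by A^3; this is why the powers of A collect into the single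
    factor A^12. *)
Lemma product_mod16 : exists E,
  (a + 2 * q * T) * (a ^+ 2 + 4 * q ^+ 2 * T ^+ 2) * a ^+ 4
    * (A ^+ 2 + 4 * q ^+ 8 * P ^+ 2) ^+ 4
  = A ^+ 12 * dissection16 + 16 * E.
Proof.
have [f cubicE] := cubic_mod2; have [f4 ->] := pow4_mod16.
have [f8 ->] := pow8_mod16; have [g gE] := cubic_dissection16.
rewrite -/cubic; have -> : dissection16 = cubic + 8 * correction - 16 * g.
  by rewrite gE; ring.
exists (A ^+ 12 * g + A ^+ 9 * correction * f + cubic * f4 * A ^+ 8
  + cubic * (A ^+ 4 + 8 * A * correction + 16 * f4) * f8).
have cE : cubic * (8 * A * correction) =
  8 * A ^+ 4 * correction + 16 * A * correction * f by rewrite cubicE; ring.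
transitivity (A ^+ 12 * cubic + A ^+ 8 * (cubic * (8 * A * correction))
  + 16 * (cubic * f4 * A ^+ 8
  + cubic * (A ^+ 4 + 8 * A * correction + 16 * f4) * f8)).
  by move: cubic correction => c m; ring.
by rewrite cE; move: cubic correction => c m; ring.
Qed.

End Mod16.

Theorem theorem2p1 :
  let phi := fps_subst phi_series ('q ^+ 16) in
  let phim := fps_subst phi_series (- 'q ^+ 16) in
  let psi := fps_subst psi_series ('q ^+ 32) in
  let psi16 := fps_subst psi_series ('q ^+ 16) in
  let psi1 := fps_subst psi1_series ('q ^+ 16) in
  let psi2 := fps_subst psi2_series ('q ^+ 16) in
  let rhs : fps int :=
       phi ^+ 12 / phim ^+ 16 *
        (phi ^+ 3
         - 2 * (4 * 'q ^+ 16 * psi ^+ 2 * psi2 + 7 * phi ^+ 2 * psi1) * 'q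
         + 4 * phi * ('q ^+ 16 * psi2 ^+ 2 + psi1 ^+ 2) * 'q ^+ 2
         + 8 * psi1 * ('q ^+ 16 * psi2 ^+ 2 + psi1 ^+ 2) * 'q ^+ 3
         + 2 * phi * (4 * psi16 ^+ 2 + 3 * phi * psi) * 'q ^+ 4
         + 8 * phi * psi * psi1 * 'q ^+ 5
         + 8 * psi * ('q ^+ 16 * psi2 ^+ 2 + psi1 ^+ 2) * 'q ^+ 6
         + 4 * phi * psi ^+ 2 * 'q ^+ 8
         - 2 * (7 * phi ^+ 2 * psi2 + 4 * psi ^+ 2 * psi1) * 'q ^+ 9
         + 8 * phi * psi1 * psi2 * 'q ^+ 10
         + 8 * psi2 * ('q ^+ 16 * psi2 ^+ 2 + psi1 ^+ 2) * 'q ^+ 11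
         + 8 * psi ^+ 3 * 'q ^+ 12
         + 8 * phi * psi * psi2 * 'q ^+ 13) in
  forall n : nat, (overp_series n = rhs n %[mod 16])%Z.
Proof.
move=> phi phim psi psi16 psi1 psi2 rhs n.
have phiE : phi = dilate 16 phi_series := fps_subst_Xn _ 15.
have phimE : phim = dilate 16 (alternate phi_series) := fps_subst_oppXn _ 15.
have psiE : psi = dilate 32 psi_series := fps_subst_Xn _ 31.
have psi16E : psi16 = dilate 16 psi_series := fps_subst_Xn _ 15.
have psi1E : psi1 = dilate 16 psi1_series := fps_subst_Xn _ 15.
have psi2E : psi2 = dilate 16 psi2_series := fps_subst_Xn _ 15.
clearbody phi phim psi psi16 psi1 psi2.
have phi_odd : phi = 1 + 2 * dilate 16 (gf (fun k : nat => k.+1%:Z ^+ 2)).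
  by rewrite phiE phi_gf_nat rmorphD rmorph1 raddfMn /=; ring.
have [g g_sqr] := psi_sqr_mod2.
have psi16_sqr : psi16 ^+ 2 = psi + 2 * dilate 16 g.
  rewrite psi16E -rmorphXn g_sqr rmorphD raddfMn /= dilate_dilate psiE; ring.
have phi4 : dilate 4 phi_series = phi + 2 * 'q ^+ 4 * psi.
  rewrite {1}phi_dissection rmorphD !rmorphM rmorph_nat /= dilateX.
  by rewrite !dilate_dilate -phiE -psiE.
have psi8 : dilate 8 psi_series = psi1 + 'q ^+ 8 * psi2.
  rewrite psi1E psi2E {1}psi_dissection rmorphD rmorphM /= dilateX.
  by rewrite !dilate_dilate.
have phi1 : phi_series = dilate 4 phi_series + 2 * 'q * (psi1 + 'q ^+ 8 * psi2).
  by rewrite {1}phi_dissection psi8.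
have phi2 : dilate 2 phi_series ^+ 2 =
    dilate 4 phi_series ^+ 2 + 4 * 'q ^+ 2 * (psi1 + 'q ^+ 8 * psi2) ^+ 2.
  rewrite -rmorphXn phi_sqr rmorphD /= !(rmorphXn, rmorphM, rmorph_nat) /=
    dilateX.
  by rewrite !dilate_dilate -psi8.
have phi8 : dilate 8 phi_series ^+ 2 = phi ^+ 2 + 4 * 'q ^+ 8 * psi ^+ 2.
  rewrite -rmorphXn phi_sqr rmorphD /= !(rmorphXn, rmorphM, rmorph_nat) /=
    dilateX.
  by rewrite !dilate_dilate -phiE -psiE.
have [E productE] := product_mod16 'q psi1 psi2 phi_odd psi16_sqr.
have phim_unit : phim ^+ 16 \is a GRing.unit.
  rewrite unitrX // phimE rmorph_unit //; apply/unitrPr.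
  by exists overp_series; rewrite mulrC overp_alternate_phi.
have rhsE : rhs =
  phi ^+ 12 / phim ^+ 16 * dissection16 'q phi psi psi16 psi1 psi2 := erefl.
clearbody rhs.
have overpE : overp_series * phim ^+ 16 =
    phi ^+ 12 * dissection16 'q phi psi psi16 psi1 psi2 + 16 * E.
  rewrite phimE overp_series_phi16 (exprM _ 2 4) phi8 phi2 {1}phi1 phi4.
  exact: productE.
have -> : overp_series = rhs + (E / phim ^+ 16) *+ 16.
  apply: (mulIr phim_unit); rewrite overpE [RHS]mulrDl; congr (_ + _).
    by rewrite rhsE [RHS]mulrAC (divrK phim_unit).
  by rewrite [RHS]mulrnAl (divrK phim_unit) mulr_natl.
by rewrite fps_coefD fps_coefMn -[_ *+ 16]mulr_natr natz addrC modzMDl.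
Qed.
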